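(* Let $\Gamma$ be a finite topological network with edges $e_j$ ($j\in J$), boundary vertices $v_i$ ($i\in I_B$) and transition vertices $v_i$ ($i\in I_T$). Let $\beta=(\beta_{ij})_{i\in I_T,\,j\in Inc_i}$ be a collection with $\beta_{ij}\ge 0$, let $f$ be a continuous, non-negative function on $\Gamma$, and let $g_i\in\mathbb{R}$ for $i\in I_B$. Then for any $\varepsilon>0$ there exists a unique solution $u_\varepsilon\in C^2_{*,\beta}(\Gamma)$ of $$-\varepsilon\,\partial_j^2u+|\partial_j u|^2-f(x)=0\quad x\in e_j,\ j\in J,\qquad u(v_i)=g_i\quad i\in I_B.$$
   Context: Topological network: let $V=\{v_i: i\in I\}$ be a finite set of points of $\mathbb{R}^n$ and $\pi_j:[0,l_j]\to\mathbb{R}^n$, $l_j>0$, $j\in J$ ($J$ finite), smooth non-self-intersecting curves; put $e_j:=\pi_j((0,l_j))$, $\bar e_j:=\pi_j([0,l_j])$. Assume: (i) $\pi_j(0),\pi_j(l_j)\in V$ and $\#(\bar e_j\cap V)=2$ for all $j$; (ii) $\bar e_j\cap\bar e_k\subset V$ and $\#(\bar e_j\cap\bar e_k)\le 1$ for $j\ne k$; (iii) any two vertices are joined by a path of edges. Then $\Gamma:=\bigcup_{j\in J}\bar e_j$. A point $x\in\bar e_j$ is identified with $\pi_j^{-1}(x)\in[0,l_j]$. $Inc_i:=\{j\in J: e_j\text{ is incident to }v_i\}$. The signed incidence matrix is $a_{ij}=1$ if $v_i\in\bar e_j$ and $\pi_j(0)=v_i$, $a_{ij}=-1$ if $v_i\in\bar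 e_j$ and $\pi_j(l_j)=v_i$, $a_{ij}=0$ otherwise. A nonempty set $I_B\subset I$ is fixed, containing every $i$ with $\#Inc_i=1$; moreover it is assumed (without loss of generality) that $\#Inc_i=1$ for every $i\in I_B$. $\partial\Gamma:=\{v_i:i\in I_B\}$ (boundary vertices), $I_T:=I\setminus I_B$ (transition vertices are the $v_i$, $i\in I_T$). Function spaces: for $u:\Gamma\to\mathbb{R}$, $u^j:=u\circ\pi_j:[0,l_j]\to\mathbb{R}$, and $\partial_j^\alpha u(x):=\frac{d^\alpha u^j}{dy^\alpha}(\pi_j^{-1}(x))$ for $x\in e_j$ or $x=v_i$ with $j\in Inc_i$ (one-sided at endpoints). $u\in C^k(\Gamma)$ means $u$ is continuous on $\Gamma$ and $u^j\in C^k([0,l_j])$ for all $j\in J$. For a collection $\beta=(\beta_{ij})_{i\in I_T,\,j\in Inc_i}$ with $\beta_{ij}\ge0$, $C^k_{*,\beta}(\Gamma)$ ($k\ge1$) is the set of $u\in C^k(\Gamma)$ satisfying the Kirchhoff condition $S^i_\beta u:=\sum_{j\in Inc_i}\beta_{ij}a_{ij}\partial_ju(v_i)=0$ for all $i\in I_T$.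
   Formalization: Added hypothesis: from each transition vertex a boundary vertex is reachable by a chain of edges, each leaving its starting transition vertex v_i along an e_j with β_ij>0. For merely β_ij≥0 the claim is false: with β=0 at a vertex the Kirchhoff condition is void and uniqueness fails. *)

(* Defs.v *)
From HB Require Import structures.
From mathcomp Require Import all_boot all_order all_algebra.
From mathcomp Require Import all_classical all_reals all_analysis.

Set Implicit Arguments.
Unset Strict Implicit.
Unset Printing Implicit Defensive.

Import Order.TTheory GRing.Theory Num.Theory.
Import numFieldTopology.Exports numFieldNormedType.Exports.

Local Open Scope classical_set_scope.
Local Open Scope card_scope.
Local Open Scope ring_scope.

Section IntervalCalculus.
Context {R : realType}.

Definition itv_quotient (g : R -> R) (x y : R) : R := (g y - g x) / (y - x).

(* The increment is restricted to [0, l], so at x = 0 and x = l these are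
   one-sided notions; only points x of [0, l] are meaningful. *)
Definition itv_derivable (l : R) (g : R -> R) (x : R) : Prop :=
  cvg (itv_quotient g x y @[y --> within `[0, l] x^']).

Definition itv_derive (l : R) (g : R -> R) (x : R) : R :=
  lim (itv_quotient g x y @[y --> within `[0, l] x^']).

Definition itv_deriven (l : R) (m : nat) (g : R -> R) : R -> R :=
  iter m (itv_derive l) g.

Definition itv_Ck (k : nat) (l : R) (g : R -> R) : Prop :=
  (forall m : nat, (m < k)%N ->
     {in `[0, l], forall x, itv_derivable l (itv_deriven l m g) x}) /\
  (forall m : nat, (m <= k)%N ->
     {within `[0, l], continuous (itv_deriven l m g)}).

End IntervalCalculus.

Record network (R : realType) (n : nat) (I J : finType) := Network {
  vertex : I -> 'rV[R]_n ;
  len : J -> R ;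
  curve : J -> R -> 'rV[R]_n ; (* only its values on [0, len j] matter *)
  bnd : {set I} }.

Section Network.
Context {R : realType} {n : nat} {I J : finType} (G : network R n I J).

Definition vertices : set 'rV[R]_n := range (vertex G).

Definition edge (j : J) : set 'rV[R]_n := curve G j @` `]0, len G j[.

Definition cedge (j : J) : set 'rV[R]_n := curve G j @` `[0, len G j].

Definition carrier : set 'rV[R]_n := \bigcup_(j in [set: J]) cedge j.

Definition Inc (i : I) : {set J} := [set j : J | `[< cedge j (vertex G i) >]]%SET.

Definition transition : {set I} := (~: bnd G)%SET.

Definition vadjacent : rel I :=
  fun i k => [exists j : J, (j \in Inc i) && (j \in Inc k)].

Record topological_network : Prop := TopologicalNetwork {
  vertex_inj : injective (vertex G) ;
  len_gt0 : forall j, 0 < len G j ;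
  curve_smooth : forall (j : J) (c : 'I_n) (k : nat),
    itv_Ck k (len G j) (fun t => curve G j t ord0 c) ;
  curve_inj : forall j : J, {in `[0, len G j] &, injective (curve G j)} ;
  curve_start : forall j : J, vertices (curve G j 0) ;
  curve_end : forall j : J, vertices (curve G j (len G j)) ;
  cedge_vertices : forall j : J, cedge j `&` vertices #= `I_2 ;
  cedge_meet : forall j k : J, j != k -> cedge j `&` cedge k `<=` vertices ;
  cedge_meet_card : forall j k : J, j != k -> cedge j `&` cedge k #<= `I_1 ;
  vertex_connect : forall i k : I, connect vadjacent i k ;
  bnd_neq0 : bnd G != finset.set0 ;
  bnd_leaf : forall i : I, (i \in bnd G) = (#|Inc i| == 1%N) }.

(* Signed incidence matrix. *)
Definition incidence (i : I) (j : J) : R :=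
  if (j \in Inc i) && (curve G j 0 == vertex G i) then 1
  else if (j \in Inc i) && (curve G j (len G j) == vertex G i) then -1
  else 0.

Definition param (j : J) (x : 'rV[R]_n) : R :=
  get [set t | t \in `[0, len G j] /\ curve G j t = x].

(* Functions on the network are represented by total functions on R^n, of
   which only the values on [carrier] are relevant. *)
Definition dedge (m : nat) (j : J) (u : 'rV[R]_n -> R) (x : 'rV[R]_n) : R :=
  itv_deriven (len G j) m (u \o curve G j) (param j x).

Definition network_Ck (k : nat) (u : 'rV[R]_n -> R) : Prop :=
  {within carrier, continuous u} /\
  forall j : J, itv_Ck k (len G j) (u \o curve G j).

Definition kirchhoff (beta : I -> J -> R) (u : 'rV[R]_n -> R) (i : I) : R :=
  \sum_(j in Inc i) beta i j * incidence i j * dedge 1 j u (vertex G i).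

Definition network_Ck_kirchhoff (beta : I -> J -> R) (k : nat)
    (u : 'rV[R]_n -> R) : Prop :=
  network_Ck k u /\ forall i, i \in transition -> kirchhoff beta u i = 0.

Definition beta_step (beta : I -> J -> R) : rel I :=
  fun i k => (i \in transition) &&
    [exists j : J, [&& j \in Inc i, j \in Inc k & 0 < beta i j]].

(* Without this condition the Dirichlet problem below is ill-posed: if
   [beta i] vanishes on [Inc i], the condition at the vertex i is void and
   u (vertex i) is free; and if the vertices reachable from i form a set of
   transition vertices, then u can be shifted there when f = 0, while no
   solution exists when f is positive on the edges involved. It follows from
   [vertex_connect] and [bnd_neq0] when all the [beta i j] are positive. *)
Definition beta_nondegenerate (beta : I -> J -> R) : Prop :=
  forall i : I, i \in transition ->
    exists2 k : I, k \in bnd G & connect (beta_step beta) i k.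

Definition viscous_solution (beta : I -> J -> R) (f : 'rV[R]_n -> R)
    (g : I -> R) (eps : R) (u : 'rV[R]_n -> R) : Prop :=
  [/\ network_Ck_kirchhoff beta 2 u,
      forall (j : J) (x : 'rV[R]_n), edge j x ->
        - eps * dedge 2 j u x + `|dedge 1 j u x| ^+ 2 - f x = 0 &
      forall i : I, i \in bnd G -> u (vertex G i) = g i].

End Network.

(* Main.v *)
Require Import Defs.
From mathcomp Require Import all_boot all_order all_algebra.
From mathcomp Require Import all_classical all_reals all_analysis.
From mathcomp Require Import ring lra.

Import Order.TTheory GRing.Theory Num.Theory.
Import numFieldTopology.Exports numFieldNormedType.Exports.

Local Open Scope classical_set_scope.
Local Open Scope ring_scope.

(** The Hopf-Cole substitution [y = exp (- u / eps)] turns the equation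
    [- eps u'' + |u'|^2 = f] into the linear equation [y'' = q y] with
    [q = f / eps^2 >= 0].  As [u' = - eps y' / y] and [y] takes a single positive
    value at each vertex, the Kirchhoff condition for [u] is equivalent to the one
    for [y], which is linear, and the boundary condition becomes
    [y = exp (- g / eps)].

    On one edge, the linear equation has fundamental solutions [c] and [s]
    ([fundamental_exists], by Picard iteration).  As [q >= 0], [s] does not vanish
    at the far end, so a solution on the edge is determined by its two end values,
    and its end slopes are explicit linear functions of them ([hopf_cole]).
    Conversely, two positive end values are interpolated by a positive solution,
    whose logarithm solves the original equation ([hopf_cole_inv]).

    So only the values [W] at the vertices remain unknown, and [viscous_solutionP]
    shows that the Kirchhoff condition is a discrete elliptic equation
    [sum_k weight i k * (W k - W i) = loss i * W i] with nonnegative coefficients.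
    It satisfies a minimum principle ([min_principle]), because by nondegeneracy
    the boundary can be reached from every transition vertex along positive
    weights.  The principle gives uniqueness of [W]; the system being square and
    finite, it gives existence; and it shows that [W] is positive for positive
    boundary data, so that the substitution can be reversed. *)

(** * One-variable calculus *)

Lemma is_derive_shape {R : realType} {f g : R -> R} {x a b : R} :
  is_derive x 1 f a -> f =1 g -> a = b -> is_derive x 1 g b.
Proof. by move=> fa /funext <- <-. Qed.

Lemma is_derive_continuous {R : realType} (f : R -> R) (x a : R) :
  is_derive x 1 f a -> {for x, continuous f}.
Proof.
by move=> fa; apply: differentiable_continuous; exact/derivable1_diffP.
Qed.

Lemma is_derive_scale {R : realType} (k : R) {f : R -> R} {x a : R} :
  is_derive x 1 f a -> is_derive x 1 (fun t => k * f t) (k * a).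
Proof. by move=> fa; exact: (is_deriveZ k fa). Qed.

Lemma is_derive_mul {R : realType} {f g : R -> R} {x a b : R} :
  is_derive x 1 f a -> is_derive x 1 g b ->
  is_derive x 1 (fun t => f t * g t) (a * g x + f x * b).
Proof.
move=> fa gb; apply: (is_derive_shape (is_deriveM fa gb)) => //.
by rewrite addrC [a * _]mulrC.
Qed.

Lemma mean_value {R : realType} (f df : R -> R) (x y : R) : x <= y ->
  (forall t, x <= t <= y -> is_derive t 1 f (df t)) ->
  exists2 c, x <= c <= y & f y - f x = df c * (y - x).
Proof.
move=> xy fd; case: (@MVT_segment _ f df x y xy).
- by move=> t; rewrite in_itv/= => /andP[xt ty]; apply: fd; rewrite !ltW.
- apply: derivable_within_continuous => t; rewrite in_itv/= => /fd ft.
  exact: ex_derive.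
- by move=> c; rewrite in_itv/=; exists c.
Qed.

(** Differential equations are only given inside an edge; this is what lets their
    first integrals be read off at its ends too. *)
Lemma derive0_interior_cst {R : realType} {f df : R -> R} {l : R} :
  (forall t, 0 <= t <= l -> is_derive t 1 f (df t)) ->
  (forall t, 0 < t < l -> df t = 0) ->
  forall t, 0 <= t <= l -> f t = f 0.
Proof.
move=> fd df0 t /andP[]; rewrite le_eqVlt => /predU1P[<-//|t0 tl].
have inl u : 0 <= u <= t -> 0 <= u <= l.
  by move=> /andP[-> /le_trans]; exact.
case: (@MVT _ f df 0 t t0).
- by move=> u; rewrite in_itv/= => /andP[u0 ut]; apply/fd/inl; rewrite !ltW.
- apply: derivable_within_continuous => u; rewrite in_itv/= => /inl/fd fu.
  exact: ex_derive.
move=> u; rewrite in_itv/= => /andP[u0 ut]; rewrite df0; last first.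
  by rewrite u0 (lt_le_trans ut).
by rewrite mul0r => /eqP; rewrite subr_eq0 => /eqP.
Qed.

Lemma antiderivative_right {R : realType} (f : R -> R) (a : R) :
  continuous f -> exists F : R -> R, forall x : R, a < x -> is_derive x 1 F (f x).
Proof.
move=> fc.
exists (fun y => \int[lebesgue_measure]_(t in `[a, y]) f t)%R => x ax.
have fi : lebesgue_measure.-integrable `[a, x + 1] (EFin \o f).
  apply: continuous_compact_integrable; first exact: segment_compact.
  exact: continuous_subspaceT.
have xx1 : x < x + 1 by rewrite ltrDl.
have ax' : (BLeft a < BRight x)%E by rewrite lte_fin.
have [dF FE] := continuous_FTC1 xx1 fi ax' (fc x).
by rewrite -FE derive1E; exact: derivableP.
Qed.

(** Primitives on different half-lines differ by a constant, so those vanishing at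
    0 agree and glue to a primitive on the whole line. *)
Lemma antiderivative {R : realType} (f : R -> R) : continuous f ->
  {F : R -> R | F 0 = 0 & forall x : R, is_derive x 1 F (f x)}.
Proof.
move=> fc; apply: cid2.
have /choice[G GP] a := antiderivative_right f a fc.
have GE a b x : a < x -> a < 0 -> b < x -> b < 0 ->
    G a x - G a 0 = G b x - G b 0.
  move=> ax a0 bx b0.
  have D t : Num.max a b < t -> is_derive t 1 (fun y => G a y - G b y) 0.
    rewrite gt_max => /andP[/GP ga /GP gb].
    by apply: (is_derive_shape (is_deriveB ga gb)) => //; rewrite subrr.
  have [x0|/ltW x0] := leP 0 x.
    have [t /andP[t0 _]|c _] := @mean_value _ _ (fun=> 0) _ _ x0
        (_ : forall t, 0 <= t <= x -> is_derive t 1 (fun y => G a y - G b y) 0).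
      by apply: D; rewrite gt_max (lt_le_trans a0)// (lt_le_trans b0).
    by rewrite mul0r; lra.
  have [t /andP[t0 _]|c _] := @mean_value _ _ (fun=> 0) _ _ x0
      (_ : forall t, x <= t <= 0 -> is_derive t 1 (fun y => G a y - G b y) 0).
    by apply: D; rewrite gt_max (lt_le_trans ax)// (lt_le_trans bx).
  by rewrite mul0r; lra.
have aP (x : R) : - `|x| - 1 < x /\ - `|x| - 1 < 0.
  have := ler_norm (- x); have := normr_ge0 x; rewrite normrN; lra.
exists (fun x => G (- `|x| - 1) x - G (- `|x| - 1) 0); first by rewrite subrr.
move=> x; have [xa xb] := aP x.
have := is_deriveB (GP _ _ xa) (is_derive_cst (G (- `|x| - 1) 0) x 1).
rewrite subr0; apply: near_eq_is_derive.
near=> y.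
have [ya yb] := aP y.
apply: GE => //.
by near: y; exact: lt_nbhsr.
Unshelve. all: by end_near. Qed.

(** [h1] is nondecreasing, so it is nonpositive before [t0] and nonnegative after.
    Working on both sides of [t0] at once is what allows the whole line as
    domain below. *)
Lemma convex_critical_min {R : realType} (h h1 h2 : R -> R) (t0 : R) :
  (forall t : R, is_derive t 1 h (h1 t)) -> (forall t : R, is_derive t 1 h1 (h2 t)) ->
  (forall t, 0 <= h2 t) -> h1 t0 = 0 -> forall t, h t0 <= h t.
Proof.
move=> hd h1d h2_ge0 h1t0 t.
have h1_mono x y : x <= y -> h1 x <= h1 y.
  move=> xy; have [c _ e] := mean_value _ _ _ _ xy (fun t _ => h1d t).
  by rewrite -subr_ge0 e mulr_ge0// subr_ge0.
have [tt0|/ltW tt0] := leP t0 t.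
  have [c /andP[c0 _] e] := mean_value _ _ _ _ tt0 (fun t _ => hd t).
  by rewrite -subr_ge0 e mulr_ge0 ?subr_ge0// -h1t0 h1_mono.
have [c /andP[_ c0] e] := mean_value _ _ _ _ tt0 (fun t _ => hd t).
by rewrite -subr_le0 e mulr_le0_ge0 ?subr_ge0// -h1t0 h1_mono.
Qed.

(** * The initial value problem *)

Lemma geometric_small {R : realType} (c e : R) : 0 < e ->
  exists n, c * 2^-1 ^+ n < e.
Proof.
move=> e0.
have h1 : `|2^-1 : R| < 1 by rewrite ger0_norm; lra.
have /cvgrPdist_lt /(_ _ e0) [n _ /(_ n (leqnn n))] := cvg_geometric c h1.
by rewrite /= sub0r normrN => /(le_lt_trans (ler_norm _)); exists n.
Qed.

(** The intervals of radius [2 c 2^-n] around [Y n] are nested; [y] is a common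
    point. *)
Lemma geometric_limit {R : realType} (Y : nat -> R) (c : R) :
  (forall n, `|Y n.+1 - Y n| <= c * 2^-1 ^+ n) ->
  exists y, forall n, `|y - Y n| <= 2 * c * 2^-1 ^+ n.
Proof.
move=> Yc.
pose L n := Y n - 2 * c * 2^-1 ^+ n; pose U n := Y n + 2 * c * 2^-1 ^+ n.
have LS n : L n <= L n.+1.
  by have := Yc n; rewrite /L exprS ler_norml; lra.
have US n : U n.+1 <= U n.
  by have := Yc n; rewrite /U exprS ler_norml; lra.
have LU n : L n <= U n.
  by have := le_trans (normr_ge0 _) (Yc n); rewrite /L /U; lra.
have Lm m n : (m <= n)%N -> L m <= L n.
  by move: m n; apply/nondecreasing_seqP.
have Um m n : (m <= n)%N -> U n <= U m.
  by move: m n; apply/nonincreasing_seqP.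
have LUmn m n : L m <= U n.
  apply: (le_trans (Lm _ _ (leq_maxl m n))).
  exact: (le_trans (LU _) (Um _ _ (leq_maxr m n))).
have supL : has_sup (range L).
  by split; [exists (L 0), 0 | exists (U 0) => _ [m _ <-]].
exists (sup (range L)) => n.
have := ub_le_sup supL.2 (ex_intro2 _ _ n I erefl : range L (L n)).
have : sup (range L) <= U n by apply: (ge_sup supL.1) => _ [m _ <-].
by rewrite ler_norml /L /U; lra.
Qed.

(** Picard iteration, run on the whole line.  In the norm weighted by
    [E t = e^(l t) + e^(- l t)] a double primitive costs a factor
    [l^-2] because [E'' = l^2 E], so for [l^2 >= 2 K] the Picard operator
    contracts by [1/2]. *)
Lemma linear_ivp {R : realType} (q : R -> R) (K a b : R) :
  continuous q -> (forall t, `|q t| <= K) ->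
  exists y y1 : R -> R, [/\ y 0 = a, y1 0 = b,
    forall t : R, is_derive t 1 y (y1 t) &
    forall t : R, is_derive t 1 y1 (q t * y t)].
Proof.
move=> qc qK.
have K0 : 0 <= K by exact: le_trans (normr_ge0 _) (qK 0).
(* Besides [2 K <= l^2], the choice ensures [1 <= l], so that [E] dominates affine functions. *)
pose l := 2 * K + 1.
have l1 : 1 <= l by rewrite /l; lra.
have lK : 2 * K <= l * l by rewrite /l; nra.
pose E (t : R) := expR (l * t) + expR (- l * t).
pose E1 (t : R) := l * (expR (l * t) - expR (- l * t)).
have dexp (k t : R) : is_derive t 1 (fun s => expR (k * s)) (k * expR (k * t)).
  apply: (is_derive_shape (is_derive1_comp (is_derive_expR (k * t))
    (is_derive_scale k (is_derive_id t 1)))) => //.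
  by rewrite mulr1 mulrC.
have Ed (t : R) : is_derive t 1 E (E1 t).
  apply: (is_derive_shape (is_deriveD (dexp l t) (dexp (- l) t))) => //.
  by rewrite /E1; lra.
have E1d (t : R) : is_derive t 1 E1 (l * l * E t).
  apply: (is_derive_shape (is_derive_scale l (is_deriveB (dexp l t) (dexp (- l) t)))) => //.
  by rewrite /E; ring.
have E10 : E1 0 = 0 by rewrite /E1 !mulr0 subrr mulr0.
have E_ge t : 1 + l * `|t| <= E t.
  rewrite /E; have := expR_ge0 (l * t); have := expR_ge0 (- l * t).
  have := expR_ge1Dx (l * t); have := expR_ge1Dx (- l * t).
  by case: (ger0P t) => t0; lra.
have E_gt0 t : 0 < E t.
  apply: lt_le_trans (E_ge t); have := normr_ge0 t; nra.
have /choice[T TP] (y : R -> R) : exists z : R -> R, continuous y ->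
    exists z1 : R -> R, [/\ z 0 = a, z1 0 = b,
    forall t : R, is_derive t 1 z (z1 t) &
    forall t : R, is_derive t 1 z1 (q t * y t)].
  have [yc|nyc] := pselect (continuous y); last by exists y.
  have [G G0 Gd] := antiderivative _ (fun t => cvgM (qc t) (yc t)).
  have G1d (t : R) : is_derive t 1 (fun t => G t + b) (q t * y t).
    apply: (is_derive_shape (is_deriveD (Gd t) (is_derive_cst b t 1))) => //.
    by rewrite addr0.
  have [F F0 Fd] := antiderivative (fun t => G t + b)
    (fun t => is_derive_continuous _ _ _ (G1d t)).
  exists (fun t => F t + a) => _; exists (fun t => G t + b); split => //.
  - by rewrite F0 add0r.
  - by rewrite G0 add0r.
  move=> t; apply: (is_derive_shape (is_deriveD (Fd t) (is_derive_cst a t 1))) => //.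
  by rewrite addr0.
have Tc y : continuous y -> continuous (T y).
  by move=> /TP [z1 [_ _ zd _]] t; exact: is_derive_continuous (zd t).
have contr y z (c : R) : continuous y -> continuous z ->
    (forall t, `|y t - z t| <= c * E t) ->
    forall t, `|T y t - T z t| <= c * 2^-1 * E t.
  move=> yc zc yz t.
  have [y1 [y0 y10 yd y1d]] := TP _ yc; have [z1 [z0 z10 zd z1d]] := TP _ zc.
  have c0 : 0 <= c.
    have := le_trans (normr_ge0 _) (yz 0).
    by rewrite pmulr_lge0.
  (* [c / 2 * E] plus or minus [T y - T z] is convex with critical point 0. *)
  have side (s : R) : `|s| = 1 -> 0 <= c * 2^-1 * E t + s * (T y t - T z t).
    move=> s1.
    have hd (u : R) : is_derive u 1 (fun u => c * 2^-1 * E u + s * (T y u - T z u))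
        (c * 2^-1 * E1 u + s * (y1 u - z1 u)).
      exact: (is_derive_shape (is_deriveD (is_derive_scale (c * 2^-1) (Ed u))
        (is_derive_scale s (is_deriveB (yd u) (zd u))))).
    have h1d (u : R) : is_derive u 1 (fun u => c * 2^-1 * E1 u + s * (y1 u - z1 u))
        (c * 2^-1 * (l * l * E u) + s * (q u * y u - q u * z u)).
      exact: (is_derive_shape (is_deriveD (is_derive_scale (c * 2^-1) (E1d u))
        (is_derive_scale s (is_deriveB (y1d u) (z1d u))))).
    apply: (le_trans _ (convex_critical_min _ _ _ 0 hd h1d _ _ t)).
    - by rewrite y0 z0 subrr mulr0 addr0 !mulr_ge0// ltW.
    - move=> u; rewrite -mulrBr.
      have : `|s * (q u * (y u - z u))| <= K * (c * E u).
        by rewrite !normrM s1 mul1r ler_pM.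
      rewrite ler_norml => /andP[+ _].
      have : 2 * K * (c * E u) <= l * l * (c * E u).
        by rewrite ler_wpM2r// mulr_ge0// ltW.
      by lra.
    - by rewrite E10 y10 z10 subrr !mulr0 addr0.
  have := side 1 (normr1 _); have := side (-1) (normrN1 _).
  by rewrite ler_norml; lra.
pose Y n := iter n T (fun=> 0).
have Yc n : continuous (Y n).
  by elim: n => [|n IH]; [exact: cst_continuous | exact: Tc].
pose c0 := `|a| + `|b|.
have Y1 n t : `|Y n.+1 t - Y n t| <= c0 * 2^-1 ^+ n * E t.
  elim: n t => [t|n IH t].
    rewrite expr0 mulr1 /Y /= subr0.
    have [z1 [z0 z10 zd z1d]] := TP _ (Yc 0%N).
    have z1E u : z1 u = b.
      rewrite -z10; apply: is_derive_0_is_cst => v.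
      by apply: is_derive_shape (z1d v) _ _ => //; rewrite mulr0.
    have -> : T (fun=> 0) t = a + b * t.
      apply/eqP; rewrite -subr_eq0; apply/eqP.
      transitivity (T (fun=> 0) 0 - (a + b * 0)); last by rewrite z0; lra.
      apply: (@is_derive_0_is_cst _ (fun t => T (fun=> 0) t - (a + b * t))) => v.
      apply: (is_derive_shape (is_deriveB (zd v)
        (is_deriveD (is_derive_cst a v 1) (is_derive_scale b (is_derive_id v 1))))) => //.
      by rewrite z1E add0r mulr1 subrr.
    apply: (le_trans (ler_normD _ _)); rewrite normrM /c0.
    have := E_ge t; have := normr_ge0 t; have := normr_ge0 a; have := normr_ge0 b.
    move: `|a| `|b| `|t| => A B u B0 A0 u0 Et.
    have : (A + B) * (1 + u) <= (A + B) * E t.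
      by apply: ler_wpM2l; [exact: addr_ge0 | nra].
    by nra.
  by rewrite exprSr mulrA; exact: (contr (Y n.+1) (Y n)).
have /choice[y yP] t : exists y, forall n,
    `|y - Y n t| <= 2 * c0 * 2^-1 ^+ n * E t.
  have [|y yP] := geometric_limit (fun n => Y n t) (c0 * E t).
    by move=> n; apply: le_trans (Y1 n t) _; rewrite mulrAC.
  by exists y => n; apply: le_trans (yP n) _; rewrite mulrA mulrAC.
have yc : continuous y.
  (* [E] is bounded near [t], so the convergence is locally uniform. *)
  move=> t; apply/cvgrPdist_le => e e0.
  have e3 : 0 < e / 3 by rewrite divr_gt0.
  have [n] := geometric_small (2 * c0 * (E t + 1)) (e / 3) e3.
  have Ec : {for t, continuous E} := is_derive_continuous _ _ _ (Ed t).
  have c00 : 0 <= 2 * c0 * 2^-1 ^+ n by rewrite !mulr_ge0 ?addr_ge0 ?exprn_ge0.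
  move=> nE; near=> s.
  have Es : E s <= E t + 1.
    by apply/ltW; near: s; apply: cvgr_lt Ec _ _; rewrite ltrDl.
  have Ys : `|Y n t - Y n s| <= e / 3.
    near: s; have /cvgrPdist_le := Yc n t; exact.
  have ys := le_trans (yP s n) (ler_wpM2l c00 Es).
  have yt := le_trans (yP t n) (ler_wpM2l c00 (_ : E t <= E t + 1)).
  have {}yt := yt (ltW (ltr_pwDr ltr01 (lexx _))).
  move: ys yt Ys; rewrite !ler_norml; lra.
have [y1 [y0 y10 yd y1d]] := TP _ yc.
(* [T y] and [y] are both within [O(2^-n)] of the iterate [Y n.+1]. *)
have Ty : T y = y.
  apply/funext => t; apply/eqP; rewrite -subr_eq0 -normr_le0 leNgt; apply/negP => e0.
  have [n] := geometric_small (2 * c0 * E t) _ e0.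
  have := contr _ _ _ yc (Yc n) (fun t => yP t n) t.
  have := yP t n.+1; rewrite exprS.
  rewrite (_ : T (Y n) = Y n.+1)// (distrC (y t)) => A B.
  have := ler_distD (Y n.+1 t) (T y t) (y t).
  by move: A B; lra.
by exists y, y1; rewrite Ty in y0 yd.
Unshelve. all: by end_near. Qed.

(** * Fundamental solutions *)

(** The solutions [c], [s] of [y'' = q y] with initial data [(1, 0)] and
    [(0, 1)]: for [q = 1] they are [cosh] and [sinh]. *)
Record fundamental {R : realType} (q c c1 s s1 : R -> R) : Prop := Fundamental {
  fund_c0 : c 0 = 1 ;
  fund_c10 : c1 0 = 0 ;
  fund_s0 : s 0 = 0 ;
  fund_s10 : s1 0 = 1 ;
  fund_c : forall t : R, is_derive t 1 c (c1 t) ;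
  fund_c1 : forall t : R, is_derive t 1 c1 (q t * c t) ;
  fund_s : forall t : R, is_derive t 1 s (s1 t) ;
  fund_s1 : forall t : R, is_derive t 1 s1 (q t * s t) }.

Arguments fund_c0 {R q c c1 s s1} _.
Arguments fund_c10 {R q c c1 s s1} _.
Arguments fund_s0 {R q c c1 s s1} _.
Arguments fund_s10 {R q c c1 s s1} _.
Arguments fund_c {R q c c1 s s1} _ _.
Arguments fund_c1 {R q c c1 s s1} _ _.
Arguments fund_s {R q c c1 s s1} _ _.
Arguments fund_s1 {R q c c1 s s1} _ _.

Lemma fundamental_exists {R : realType} (q : R -> R) (K : R) :
  continuous q -> (forall t, `|q t| <= K) ->
  exists c c1 s s1, fundamental q c c1 s s1.
Proof.
move=> qc qK; have [c [c1 [? ? ? ?]]] := linear_ivp q K 1 0 qc qK.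
by have [s [s1 [? ? ? ?]]] := linear_ivp q K 0 1 qc qK; exists c, c1, s, s1.
Qed.

Section Fundamental.
Context {R : realType} {q c c1 s s1 : R -> R}.
Hypothesis cs : fundamental q c c1 s s1.

(** The derivative of the Wronskian is [c (q s) - (q c) s = 0]. *)
Lemma wronskian (t : R) : c t * s1 t - c1 t * s t = 1.
Proof.
transitivity (c 0 * s1 0 - c1 0 * s 0); last first.
  by rewrite (fund_c0 cs) (fund_s10 cs) (fund_s0 cs); lra.
apply: (@is_derive_0_is_cst _ (fun t => c t * s1 t - c1 t * s t)) => u.
apply: (is_derive_shape (is_deriveB
  (is_derive_mul (fund_c cs u) (fund_s1 cs u))
  (is_derive_mul (fund_c1 cs u) (fund_s cs u)))) => //.
ring.
Qed.

(** The Wronskians of [z] with [s] and with [c] are constant.  Their values at 0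
    give two linear equations for [(z t, z1 t)], with determinant 1 by
    [wronskian].  This gives uniqueness for the initial value problem as well. *)
Lemma solution_fundamentalE {l : R} {z z1 z2 : R -> R} :
  (forall t, 0 <= t <= l -> is_derive t 1 z (z1 t)) ->
  (forall t, 0 <= t <= l -> is_derive t 1 z1 (z2 t)) ->
  (forall t, 0 < t < l -> z2 t = q t * z t) ->
  forall t, 0 <= t <= l ->
    z t = z 0 * c t + z1 0 * s t /\ z1 t = z 0 * c1 t + z1 0 * s1 t.
Proof.
move=> zd z1d z2E t tl.
have ws : z t * s1 t - z1 t * s t = z 0.
  transitivity (z 0 * s1 0 - z1 0 * s 0); last first.
    by rewrite (fund_s0 cs) (fund_s10 cs) mulr1 mulr0 subr0.
  apply: (derive0_interior_cst (f := fun u => z u * s1 u - z1 u * s u) (fun u ul =>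
    is_deriveB (is_derive_mul (zd u ul) (fund_s1 cs u))
      (is_derive_mul (z1d u ul) (fund_s cs u))) _ _ tl) => u /z2E ->.
  by ring.
have wc : z t * c1 t - z1 t * c t = - z1 0.
  transitivity (z 0 * c1 0 - z1 0 * c 0); last first.
    by rewrite (fund_c0 cs) (fund_c10 cs) mulr1 mulr0 sub0r.
  apply: (derive0_interior_cst (f := fun u => z u * c1 u - z1 u * c u) (fun u ul =>
    is_deriveB (is_derive_mul (zd u ul) (fund_c1 cs u))
      (is_derive_mul (z1d u ul) (fund_c cs u))) _ _ tl) => u /z2E ->.
  by ring.
have w := wronskian t.
rewrite -ws (_ : z1 0 = z1 t * c t - z t * c1 t); last by lra.
split.
  transitivity (z t * (c t * s1 t - c1 t * s t)); first by rewrite w mulr1.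
  by ring.
transitivity (z1 t * (c t * s1 t - c1 t * s t)); first by rewrite w mulr1.
by ring.
Qed.

Hypothesis q_ge0 : forall t, 0 <= q t.

(** [c ^ 2] is convex with a critical point at 0, so [c ^ 2 >= 1]; in particular
    [c] does not vanish and keeps the sign of [c 0 = 1]. *)
Lemma fund_c_ge1 (t : R) : 1 <= c t.
Proof.
have sq u : 1 <= c u * c u.
  have hd (v : R) := is_derive_mul (fund_c cs v) (fund_c cs v).
  have h1d (v : R) := is_deriveD
    (is_derive_mul (fund_c1 cs v) (fund_c cs v))
    (is_derive_mul (fund_c cs v) (fund_c1 cs v)).
  suff : c 0 * c 0 <= c u * c u by rewrite (fund_c0 cs) mulr1.
  apply: (convex_critical_min _ _ _ 0 hd h1d _ _ u).
    move=> v; have := sqr_ge0 (c v); have := sqr_ge0 (c1 v); have := q_ge0 v.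
    by rewrite !expr2; nra.
  by rewrite (fund_c10 cs) mul0r mulr0 addr0.
suff c0 : 0 < c t by have := sq t; nra.
rewrite ltNge; apply/negP => c0.
have nz u : c u != 0.
  by apply/eqP => cu; have := sq u; rewrite cu mul0r ler10.
have cc u : {for u, continuous c} := is_derive_continuous _ _ _ (fund_c cs u).
have cw a b : {within `[a, b], continuous c} by exact: continuous_subspaceT.
have [t0|/ltW t0] := leP 0 t.
  have [|u _ /eqP] := IVT t0 (cw 0 t) (_ : Num.min (c 0) (c t) <= 0 <= Num.max (c 0) (c t)).
    by rewrite (fund_c0 cs) ge_min le_max c0 ler01 orbT.
  by rewrite (negbTE (nz u)).
have [|u _ /eqP] := IVT t0 (cw t 0) (_ : Num.min (c t) (c 0) <= 0 <= Num.max (c t) (c 0)).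
  by rewrite (fund_c0 cs) ge_min le_max c0 ler01 orbT.
by rewrite (negbTE (nz u)).
Qed.

Let c_gt0 (t : R) : 0 < c t.
Proof. exact: lt_le_trans (fund_c_ge1 t). Qed.

(** [s / c] increases: its derivative is [1 / c ^ 2] by the Wronskian. *)
Lemma fund_ratio_lt (x y : R) : x < y -> s x * c y < s y * c x.
Proof.
move=> xy.
have rd (t : R) : is_derive t 1 (fun u => s u * (c u)^-1) ((c t ^+ 2)^-1).
  have ct : c t != 0 by rewrite gt_eqF.
  apply: (is_derive_shape (is_derive_mul (fund_s cs t)
    (is_deriveV ct (fund_c cs t)))) => //.
  have w := wronskian t.
  rewrite [_ *: _](_ : _ = - (c t ^+ 2)^-1 * c1 t)//.
  rewrite (_ : s1 t = (1 + c1 t * s t) / c t); last first.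
    by apply: (mulIf ct); rewrite mulfVK//; lra.
  by field.
have [u _] := mean_value _ _ _ _ (ltW xy) (fun t _ => rd t).
have : 0 < (c u ^+ 2)^-1 * (y - x) by rewrite mulr_gt0 ?subr_gt0// invr_gt0 exprn_gt0.
move=> /[swap] <-; rewrite subr_gt0 ltr_pdivrMr// mulrAC ltr_pdivlMr//.
Qed.

Lemma fund_s_gt0 (t : R) : 0 < t -> 0 < s t.
Proof.
by move=> /fund_ratio_lt; rewrite (fund_s0 cs) (fund_c0 cs) mul0r mulr1.
Qed.

Lemma fund_s1_ge1 (t : R) : 0 <= t -> 1 <= s1 t.
Proof.
move=> t0; have [u /andP[u0 _]] := mean_value _ _ _ _ t0 (fun v _ => fund_s1 cs v).
rewrite (fund_s10 cs) -subr_ge0 => ->; rewrite subr0 mulr_ge0// mulr_ge0//.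
move: u0; rewrite le_eqVlt => /predU1P[<-|/fund_s_gt0/ltW//].
by rewrite (fund_s0 cs).
Qed.

End Fundamental.

(** * One-sided and two-sided differentiability on a segment *)

Definition clamp {R : realType} (l t : R) : R := Num.max 0 (Num.min t l).

(** Two-sided derivatives replacing the one-sided ones of [g] at the ends, so that
    the usual rules of calculus apply on the whole closed segment. *)
Definition C2_extension {R : realType} (l : R) (g U U1 U2 : R -> R) : Prop :=
  forall t, 0 <= t <= l -> [/\ g t = U t, is_derive t 1 U (U1 t),
    is_derive t 1 U1 (U2 t) & {for t, continuous U2}].

Section Segment.
Context {R : realType} {l : R}.
Hypothesis l_gt0 : 0 < l.

Lemma clamp_continuous : continuous (clamp l).
Proof.
move=> t; apply: (@continuous_max _ _ (fun=> 0) (fun t => Num.min t l) t).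
  exact: cst_continuous.
apply: (@continuous_min _ _ id (fun=> l) t); last exact: cst_continuous.
by move=> V.
Qed.

Lemma clamp_itv (t : R) : 0 <= clamp l t <= l.
Proof. by rewrite /clamp le_max lexx ge_max ge_min lexx orbT (ltW l_gt0). Qed.

Lemma clamp_id (t : R) : 0 <= t <= l -> clamp l t = t.
Proof. by rewrite /clamp => /andP[t0 tl]; rewrite min_l// max_r. Qed.

Lemma clamp_comp_continuous {T : topologicalType} (g : R -> T) :
  {within `[0, l], continuous g} -> continuous (g \o clamp l).
Proof.
move=> /subspace_continuousP gc t.
have ct : `[0, l]%classic (clamp l t) by rewrite /= in_itv/= clamp_itv.
apply: cvg_trans (gc _ ct) => V /= gV.
have : \forall u \near t, `[0, l]%classic (clamp l u) -> V (g (clamp l u)).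
  exact: (clamp_continuous t _ gV).
by apply: filterS => u; apply; rewrite /= in_itv/= clamp_itv.
Qed.

Lemma itv_dnbhs_proper (x : R) : 0 <= x <= l -> ProperFilter (within `[0, l] x^').
Proof.
move=> /andP[x0 xl]; apply: (@Build_ProperFilter_ex _ _ _ (within_filter _ _)) => P.
rewrite /within/= /dnbhs /within/= => /nbhs_ballP[e /= e0 eP].
have [xl'|lx] := ltP x l.
  pose y := Num.min (x + e / 2) l.
  have xy : x < y by rewrite lt_min xl' andbT ltrDl divr_gt0.
  have ye : y <= x + e / 2 by rewrite ge_min lexx.
  have yl : y <= l by rewrite ge_min lexx orbT.
  clearbody y; exists y; apply: eP; last by rewrite /= in_itv/= yl andbT; lra.
    by rewrite /ball/= distrC ger0_norm; lra.
  by rewrite gt_eqF.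
pose y := Num.max (x - e / 2) 0.
have xy : y < x by rewrite gt_max (lt_le_trans l_gt0 lx) andbT; lra.
have ye : x - e / 2 <= y by rewrite le_max lexx.
have yl : 0 <= y by rewrite le_max lexx orbT.
clearbody y; exists y; apply: eP; last by rewrite /= in_itv/= yl /=; lra.
  by rewrite /ball/= ger0_norm; lra.
by rewrite lt_eqF.
Qed.

Lemma itv_quotient_cvg {g U : R -> R} {x d : R} :
  (forall t, 0 <= t <= l -> g t = U t) -> 0 <= x <= l -> is_derive x 1 U d ->
  itv_quotient g x y @[y --> within `[0, l] x^'] --> d.
Proof.
move=> gU xl /is_derive1_caratheodory[h [hE hc <-]].
have hw : h y @[y --> within `[0, l] x^'] --> h x.
  by apply: cvg_within_filter; apply: cvg_within_filter; exact: hc.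
apply: cvg_trans hw; apply: near_eq_cvg.
rewrite near_withinE near_withinE; apply: nearW => y yx.
rewrite /= in_itv/= => yl; rewrite /itv_quotient !gU// hE mulfK//.
by rewrite subr_eq0.
Qed.

Lemma itv_derivable_is_derive {g U : R -> R} {x d : R} :
  (forall t, 0 <= t <= l -> g t = U t) -> 0 <= x <= l -> is_derive x 1 U d ->
  itv_derivable l g x /\ itv_derive l g x = d.
Proof.
move=> gU xl Ud; have qd := itv_quotient_cvg gU xl Ud.
have pf := itv_dnbhs_proper _ xl.
by split; [apply/cvg_ex; exists d | exact: (cvg_lim (@Rhausdorff R) qd)].
Qed.

Lemma itv_derivable_interior {g : R -> R} {x : R} :
  0 < x < l -> itv_derivable l g x -> is_derive x 1 g (itv_derive l g x).
Proof.
move=> xl gx; apply/is_derive1_caratheodory.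
pose h y := if y == x then itv_derive l g x else itv_quotient g x y.
exists h; split; last by rewrite /h eqxx.
- move=> z; rewrite /h; have [->|zx] := eqVneq z x; first by rewrite !subrr mulr0.
  by rewrite /itv_quotient mulfVK// subr_eq0.
- apply/continuous_withinNx.
  suff qd : itv_quotient g x y @[y --> x^'] --> h x.
    apply: cvg_trans qd; apply: near_eq_cvg.
    by rewrite near_withinE; apply: nearW => y /negbTE; rewrite /h => ->.
  rewrite {1}/h eqxx => V /gx xV.
  have {}xV : \forall y \near x^', `[0, l]%classic y -> V (itv_quotient g x y).
    exact: xV.
  have xl' : \forall y \near x^', `[0, l]%classic y.
    apply: nbhs_dnbhs.
    have : x \in `]0, l[ by rewrite in_itv/=.
    move=> /near_in_itvoo; apply: filterS => y /=.
    by rewrite !in_itv/= => /andP[? ?]; rewrite !ltW.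
  have : \forall y \near x^', V (itv_quotient g x y).
    by apply: filterS2 xV xl' => y; exact.
  exact.
Qed.

Lemma eq_on_segment {D U d : R -> R} : {within `[0, l], continuous D} ->
  (forall t : R, 0 < t < l -> is_derive t 1 D (d t)) ->
  (forall t : R, 0 <= t <= l -> is_derive t 1 U (d t)) -> D 0 = U 0 ->
  forall t, 0 <= t <= l -> D t = U t.
Proof.
move=> Dc Dd Ud DU t /andP[t0 tl].
have [u ut|u|u _] := @MVT_segment _ (fun u => D u - U u) (fun=> 0) 0 t t0.
- move: ut; rewrite in_itv/= => /andP[u0 ut].
  have ul := lt_le_trans ut tl.
  apply: (is_derive_shape (is_deriveB (Dd u _) (Ud u _))) => //.
  + by rewrite u0.
  + by rewrite !ltW.
  + by rewrite subrr.
- move: u; apply: (continuous_subspaceW (B := `[0, l])).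
    by apply: subset_itvl; rewrite bnd_simp.
  apply/subspace_continuousP => u ul.
  apply: cvgB; first by move/subspace_continuousP : Dc; exact.
  apply: cvg_within_filter; apply: is_derive_continuous (Ud u _).
  by move: ul; rewrite /= in_itv.
by rewrite mul0r DU; lra.
Qed.

(** Extend the second derivative by constants on both sides and integrate it back
    twice. *)
Lemma itv_C2_extension (g : R -> R) : itv_Ck 2 l g ->
  exists U U1 U2, C2_extension l g U U1 U2.
Proof.
move=> [gd gc].
pose g1 := itv_derive l g; pose g2 := itv_derive l g1.
have g0c : {within `[0, l], continuous g} := gc 0%N isT.
have g1c : {within `[0, l], continuous g1} := gc 1%N isT.
have g2c : {within `[0, l], continuous g2} := gc 2%N isT.
have H := clamp_comp_continuous _ g2c.
have [V V0 Vd] := antiderivative _ H.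
pose U1 t := V t + g1 0.
have U1d (t : R) : is_derive t 1 U1 (g2 (clamp l t)).
  apply: (is_derive_shape (is_deriveD (Vd t) (is_derive_cst (g1 0) t 1))) => //.
  by rewrite addr0.
have [W W0 Wd] := antiderivative U1 (fun t => is_derive_continuous _ _ _ (U1d t)).
pose U t := W t + g 0.
have Ud (t : R) : is_derive t 1 U (U1 t).
  apply: (is_derive_shape (is_deriveD (Wd t) (is_derive_cst (g 0) t 1))) => //.
  by rewrite addr0.
have in01 t : 0 < t < l -> t \in `[0, l].
  by rewrite in_itv/= => /andP[? ?]; rewrite !ltW.
have E1 t : 0 <= t <= l -> g1 t = U1 t.
  apply: (eq_on_segment g1c (d := g2)); last by rewrite /U1 V0 add0r.
    by move=> u ul; apply: itv_derivable_interior => //; exact: (gd 1%N isT u (in01 u ul)).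
  by move=> u ul; apply: (is_derive_shape (U1d u)) => //; rewrite clamp_id.
have E t : 0 <= t <= l -> g t = U t.
  apply: (eq_on_segment g0c (d := g1)); last by rewrite /U W0 add0r.
    by move=> u ul; apply: itv_derivable_interior => //; exact: (gd 0%N isT u (in01 u ul)).
  by move=> u ul; apply: (is_derive_shape (Ud u)) => //; rewrite E1.
by exists U, U1, (g2 \o clamp l) => t tl; split; [exact: E| | |exact: H].
Qed.

Lemma within_continuous_ext {g U : R -> R} :
  (forall t, 0 <= t <= l -> g t = U t /\ {for t, continuous U}) ->
  {within `[0, l], continuous g}.
Proof.
move=> gU; apply: (subspace_eq_continuous (f := U : subspace `[0, l] -> R)).
  by move=> t; rewrite inE/= in_itv/= => /gU[].
apply/subspace_continuousP => t; rewrite /= in_itv/= => /gU[_ Uc].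
by apply: cvg_within_filter; exact: Uc.
Qed.

Lemma C2_extension_derive {g U U1 U2 : R -> R} : C2_extension l g U U1 U2 ->
  forall t, 0 <= t <= l ->
    itv_deriven l 1 g t = U1 t /\ itv_deriven l 2 g t = U2 t.
Proof.
move=> gU.
have gE t : 0 <= t <= l -> g t = U t by move=> /gU[].
have E1 t : 0 <= t <= l -> itv_deriven l 1 g t = U1 t.
  by move=> tl; have [_ Ud _ _] := gU _ tl; have [] := itv_derivable_is_derive gE tl Ud.
move=> t tl; split; first exact: E1.
by have [_ _ U1d _] := gU _ tl; have [] := itv_derivable_is_derive E1 tl U1d.
Qed.

Lemma C2_extension_itv_C2 {g U U1 U2 : R -> R} : C2_extension l g U U1 U2 ->
  itv_Ck 2 l g.
Proof.
move=> gU.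
have gE t : 0 <= t <= l -> g t = U t by move=> /gU[].
have E1 t : 0 <= t <= l -> itv_deriven l 1 g t = U1 t.
  by move=> /(C2_extension_derive gU)[].
split=> [[|[|//]] _ t|[|[|[|//]]] _].
- rewrite in_itv/= => tl; have [_ Ud _ _] := gU _ tl.
  by have [] := itv_derivable_is_derive gE tl Ud.
- rewrite in_itv/= => tl; have [_ _ U1d _] := gU _ tl.
  by have [] := itv_derivable_is_derive E1 tl U1d.
- apply: (@within_continuous_ext _ U) => t tl; have [? Ud _ _] := gU _ tl.
  by split => //; exact: is_derive_continuous Ud.
- apply: (@within_continuous_ext _ U1) => t tl; have [_ _ U1d _] := gU _ tl.
  by split; [exact: E1|exact: is_derive_continuous U1d].
- apply: (@within_continuous_ext _ U2) => t tl; have [_ _ _ U2c] := gU _ tl.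
  by split => //; have [] := C2_extension_derive gU _ tl.
Qed.

End Segment.

(** * The Hopf-Cole transform on one edge *)

(** The solution of [y'' = q y] on [[0, l]] with end values [a] and [b], in terms
    of the fundamental solutions [c] and [s]. *)
Definition interpolant {R : realType} (c s : R -> R) (l a b t : R) : R :=
  a * c t + (b - a * c l) / s l * s t.

(** The equation of the theorem, with [eps ^ 2 * q] for [f]. *)
Definition viscous_eq {R : realType} (q : R -> R) (l eps : R) (u : R -> R) : Prop :=
  forall t, 0 < t < l -> - eps * itv_deriven l 2 u t
    + `|itv_deriven l 1 u t| ^+ 2 - eps ^+ 2 * q t = 0.

Section HopfCole.
Context {R : realType} {q c c1 s s1 : R -> R} {l eps : R}.
Hypothesis l_gt0 : 0 < l.
Hypothesis eps_gt0 : 0 < eps.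
Hypothesis q_cont : continuous q.
Hypothesis q_ge0 : forall t, 0 <= q t.
Hypothesis cs : fundamental q c c1 s s1.

Let sl_gt0 : 0 < s l.
Proof. exact: (fund_s_gt0 cs q_ge0). Qed.

(** Since [eps ^ 2 y'' = (- eps u'' + u' ^ 2) y], the function [y] solves
    [y'' = q y]; such a function is determined by its values at the two ends,
    and its end slopes [y' = - u' y / eps] are linear in them. *)
Lemma hopf_cole (u : R -> R) : itv_Ck 2 l u -> viscous_eq q l eps u ->
  let y t := expR (- u t / eps) in
  [/\ forall t, 0 <= t <= l -> y t = interpolant c s l (y 0) (y l) t,
      y 0 * itv_deriven l 1 u 0 = - eps * ((y l - y 0 * c l) / s l) &
      y l * itv_deriven l 1 u l = - eps * ((y l * s1 l - y 0) / s l)].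
Proof.
move=> u2 uE y.
have [U [U1 [U2 uU]]] := itv_C2_extension l_gt0 _ u2.
have dU := C2_extension_derive l_gt0 uU.
have e0 : eps != 0 by rewrite gt_eqF.
pose z t := expR (- eps^-1 * U t); pose z1 t := - eps^-1 * U1 t * z t.
pose z2 t := - eps^-1 * U2 t * z t + - eps^-1 * U1 t * z1 t.
have yz t : 0 <= t <= l -> y t = z t.
  by move=> /uU[uUt _ _ _]; rewrite /y /z uUt; congr expR; field.
have zd (t : R) : 0 <= t <= l -> is_derive t 1 z (z1 t).
  move=> /uU[_ Ud _ _].
  apply: (is_derive_shape (is_derive1_comp (is_derive_expR _)
    (is_derive_scale (- eps^-1) Ud))) => //.
  by rewrite mulrC.
have z1d (t : R) : 0 <= t <= l -> is_derive t 1 z1 (z2 t).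
  move=> tl; have [_ _ U1d _] := uU _ tl.
  exact: (is_derive_mul (is_derive_scale (- eps^-1) U1d) (zd _ tl)).
have z2E t : 0 < t < l -> z2 t = q t * z t.
  move=> tl; have := uE _ tl.
  have /dU[-> ->] : 0 <= t <= l by case/andP: tl => ? ?; rewrite !ltW.
  rewrite real_normK ?num_real// => E.
  have {}E : U2 t = (U1 t ^+ 2 - eps ^+ 2 * q t) / eps.
    by apply: (mulIf e0); rewrite divfK//; lra.
  by rewrite /z2 /z1 E; field.
have zE t (tl : 0 <= t <= l) := solution_fundamentalE cs zd z1d z2E t tl.
have l0 : 0 <= (0 : R) <= l by rewrite lexx ltW.
have ll : 0 <= l <= l by rewrite lexx ltW.
have w := wronskian cs l.
have sl : s l != 0 by rewrite gt_eqF.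
have [El E1l] := zE _ ll.
have z10 : z1 0 = (z l - z 0 * c l) / s l.
  by apply: (mulIf sl); rewrite divfK//; lra.
rewrite (yz _ l0) (yz _ ll).
split.
- by move=> t tl; rewrite (yz _ tl) (zE _ tl).1 /interpolant z10.
- by rewrite -z10 (dU _ l0).1 /z1; field.
- rewrite (dU _ ll).1.
  transitivity (- eps * z1 l); first by rewrite /z1; field.
  rewrite E1l z10; congr (_ * _); apply: (mulIf sl); rewrite divfK//.
  rewrite mulrDl [X in _ + X]mulrAC divfK//.
  have h : z 0 * (c l * s1 l - c1 l * s l) = z 0 by rewrite w mulr1.
  by rewrite -[X in _ = _ - X]h; ring.
Qed.

(** [s l * c t - s t * c l] is a solution vanishing at [l]; it is nonnegative before
    [l] because [s / c] increases. *)
Lemma interpolant_gt0 (a b t : R) : 0 < a -> 0 < b -> 0 <= t <= l ->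
  0 < interpolant c s l a b t.
Proof.
move=> a0 b0 /andP[]; rewrite le_eqVlt => /predU1P[<- _|t0 tl].
  by rewrite /interpolant (fund_c0 cs) (fund_s0 cs) mulr1 mulr0 addr0.
have -> : interpolant c s l a b t = (a * (s l * c t - s t * c l) + b * s t) / s l.
  by rewrite /interpolant; field; rewrite gt_eqF.
apply: divr_gt0 => //; apply: ltr_wpDl; last first.
  by rewrite mulr_gt0// (fund_s_gt0 cs q_ge0).
apply: mulr_ge0; first exact: ltW.
rewrite subr_ge0.
move: tl; rewrite le_eqVlt => /predU1P[->//|].
by move=> /(fund_ratio_lt cs q_ge0)/ltW.
Qed.

Lemma hopf_cole_inv (a b : R) : 0 < a -> 0 < b ->
  exists u : R -> R, [/\ itv_Ck 2 l u, viscous_eq q l eps u,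
    u 0 = - eps * ln a & u l = - eps * ln b].
Proof.
move=> a0 b0; have e0 : eps != 0 by rewrite gt_eqF.
pose k := (b - a * c l) / s l.
pose w := interpolant c s l a b; pose w1 t := a * c1 t + k * s1 t.
have wd (t : R) : is_derive t 1 w (w1 t).
  exact: (is_deriveD (is_derive_scale a (fund_c cs t)) (is_derive_scale k (fund_s cs t))).
have w1d (t : R) : is_derive t 1 w1 (q t * w t).
  apply: (is_derive_shape (is_deriveD (is_derive_scale a (fund_c1 cs t))
    (is_derive_scale k (fund_s1 cs t)))) => //.
  by rewrite /w /interpolant -/k; ring.
pose u t := - eps * ln (w t); pose u1 t := - eps * (w1 t * (w t)^-1).
pose u2 t := u1 t ^+ 2 / eps - eps * q t.
have w0 t : 0 <= t <= l -> 0 < w t by exact: interpolant_gt0.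
have ud (t : R) : 0 <= t <= l -> is_derive t 1 u (u1 t).
  move=> /w0 wt; apply: (is_derive_scale (- eps)).
  apply: (is_derive_shape (is_derive1_comp (is_derive1_ln wt) (wd t))) => //.
  by rewrite mulrC.
have u1d (t : R) : 0 <= t <= l -> is_derive t 1 u1 (u2 t).
  move=> /w0 wt; have wt0 : w t != 0 by rewrite gt_eqF.
  apply: (is_derive_shape (is_derive_scale (- eps)
    (is_derive_mul (w1d t) (is_deriveV wt0 (wd t))))) => //.
  rewrite [_ *: _](_ : _ = - (w t ^+ 2)^-1 * w1 t)// /u2 /u1.
  by field; rewrite ?wt0 ?e0.
have uE : C2_extension l u u u1 u2.
  move=> t tl; split => //; [exact: ud|exact: u1d|].
  have u1c := is_derive_continuous _ _ _ (u1d _ tl).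
  apply: (@continuousB _ _ _ (fun t => u1 t ^+ 2 / eps) (fun t => eps * q t)).
    apply: (@continuousM _ _ (fun t => u1 t ^+ 2) (fun=> eps^-1)); last exact: cst_continuous.
    exact: (@continuousM _ _ u1 u1).
  by apply: (@continuousM _ _ (fun=> eps) q); [exact: cst_continuous|exact: q_cont].
exists u; split; first exact: (C2_extension_itv_C2 l_gt0 uE).
- move=> t tl; have /(C2_extension_derive l_gt0 uE)[-> ->] : 0 <= t <= l.
    by case/andP: tl => ? ?; rewrite !ltW.
  by rewrite real_normK ?num_real// /u2; field.
- by rewrite /u /w /interpolant (fund_c0 cs) (fund_s0 cs) mulr1 mulr0 addr0.
- by rewrite /u /w /interpolant divfK ?gt_eqF// addrC subrK.
Qed.

End HopfCole.

(** * Discrete Dirichlet problem *)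

Lemma injective_solvable {F : fieldType} {I : finType} (a : I -> I -> F) :
  (forall x : I -> F, (forall i, \sum_k a i k * x k = 0) -> forall i, x i = 0) ->
  forall b : I -> F, exists x : I -> F, forall i, \sum_k a i k * x k = b i.
Proof.
move=> ainj b.
pose M := \matrix_(p < #|I|, r < #|I|) a (enum_val r) (enum_val p).
have ME (v : 'rV[F]_#|I|) i :
    (v *m M) ord0 (enum_rank i) = \sum_k a i k * v ord0 (enum_rank k).
  rewrite mxE (reindex (enum_rank : I -> _)) /=; last first.
    by exists enum_val => k _; [exact: enum_rankK|exact: enum_valK].
  by apply: eq_bigr => k _; rewrite !mxE !enum_rankK mulrC.
have : row_free M.
  apply: inj_row_free => v vM; apply/rowP => p; rewrite mxE.
  rewrite -[p]enum_valK; apply: (ainj (fun k => v ord0 (enum_rank k))) => i.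
  by rewrite -ME vM mxE.
rewrite row_free_unit => uM.
exists (fun k => ((\row_p b (enum_val p)) *m invmx M) ord0 (enum_rank k)) => i.
by rewrite -ME mulmxKV// mxE enum_rankK.
Qed.

(** A network of conductances [m] with leaks [d]: from each vertex off [B], the set
    [B] can be reached along arcs of positive conductance. *)
Section DiscreteDirichlet.
Context {R : realFieldType} {I : finType} (B : {set I}) (m : I -> I -> R) (d : I -> R).
Hypothesis m_ge0 : forall i k, i \notin B -> 0 <= m i k.
Hypothesis d_ge0 : forall i, i \notin B -> 0 <= d i.
Hypothesis B_reach : forall i, i \notin B ->
  exists2 k, k \in B & connect (fun i k => (i \notin B) && (0 < m i k)) i k.

Definition discrete_eq (W : I -> R) : Prop := forall i, i \notin B ->
  \sum_k m i k * (W k - W i) = d i * W i.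

(** At a vertex off [B] where [W] has a nonpositive minimum, the left-hand side is a
    sum of nonnegative terms and the right-hand side is nonpositive.  So all terms
    vanish, and the minimum is also attained at each neighbour of positive
    conductance; following the arcs, it is attained in [B]. *)
Lemma min_principle (W : I -> R) : discrete_eq W ->
  forall i, W i <= 0 -> exists2 b, b \in B & W b <= W i.
Proof.
move=> WE i Wi.
case: (@arg_minP _ _ _ i predT W isT) => j _ jmin.
have Wj : W j <= 0 := le_trans (jmin i isT) Wi.
suff [b bB Wb] : exists2 b, b \in B & W b = W j by exists b => //; rewrite Wb jmin.
have [jB|/B_reach[b bB /connectP[p]]] := boolP (j \in B); first by exists j.
move=> jp bE; exists b => //; rewrite bE.
suff : forall k, W k = W j -> path (fun i k => (i \notin B) && (0 < m i k)) k p ->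
  W (last k p) = W j by apply.
elim: p {jp bE} => [//|k p IH] h Wh /= /andP[/andP[hB mhk] kp].
apply: (IH k) => //; apply/eqP; rewrite -Wh -subr_eq0.
have term_ge0 r : 0 <= m h r * (W r - W h).
  by rewrite mulr_ge0 ?m_ge0// subr_ge0 Wh jmin.
have sum_le0 : \sum_r m h r * (W r - W h) <= 0.
  by rewrite WE// mulr_ge0_le0 ?d_ge0// Wh.
have : \sum_r m h r * (W r - W h) == 0.
  by rewrite eq_le sum_le0 sumr_ge0.
rewrite psumr_eq0// => /allP/(_ k (mem_index_enum _)) /=.
by rewrite mulf_eq0 gt_eqF.
Qed.

Lemma discrete_gt0 (W : I -> R) : discrete_eq W ->
  (forall i, i \in B -> 0 < W i) -> forall i, 0 < W i.
Proof.
move=> WE WB i; rewrite ltNge; apply/negP => /[dup] Wi /(min_principle _ WE)[b].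
by move=> /WB bW /le_trans/(_ Wi); rewrite leNgt bW.
Qed.

Lemma discrete_eq0 (W : I -> R) : discrete_eq W ->
  (forall i, i \in B -> W i = 0) -> forall i, W i = 0.
Proof.
have half (V : I -> R) : discrete_eq V -> (forall i, i \in B -> V i = 0) ->
    forall i, 0 <= V i.
  move=> VE VB i; rewrite leNgt; apply/negP => Vi.
  have [b /VB ->] := min_principle _ VE _ (ltW Vi).
  by rewrite leNgt Vi.
move=> WE WB i; apply/eqP; rewrite eq_le half// andbT -oppr_ge0.
apply: (half (fun i => - W i)) => [k kB|k /WB ->]; last by rewrite oppr0.
by rewrite mulrN -WE// -sumrN; apply: eq_bigr => h _; rewrite -mulrN opprB opprK addrC.
Qed.

Lemma discrete_uniq (V W : I -> R) : discrete_eq V -> discrete_eq W ->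
  (forall i, i \in B -> V i = W i) -> V =1 W.
Proof.
move=> VE WE VW i; apply/eqP; rewrite -subr_eq0; apply/eqP.
apply: (discrete_eq0 (fun i => V i - W i)) => [k kB|k /VW ->]; last exact: subrr.
rewrite mulrBr -VE// -WE// -sumrB; apply: eq_bigr => h _; rewrite -mulrBr.
by congr (_ * _); ring.
Qed.

(** The system is square, so uniqueness gives existence. *)
Lemma discrete_exists (b : I -> R) :
  exists2 W, discrete_eq W & forall i, i \in B -> W i = b i.
Proof.
pose S i := \sum_k m i k + d i.
pose a i k := if i \in B then (k == i)%:R else m i k - (k == i)%:R * S i.
have delta i (x : I -> R) : \sum_k (k == i)%:R * x k = x i.
  rewrite (bigD1 i)//= eqxx mul1r big1 ?addr0// => k /negbTE ->.
  by rewrite mul0r.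
have aB i x : i \in B -> \sum_k a i k * x k = x i.
  by move=> iB; under eq_bigr do rewrite /a iB; exact: delta.
have aT i x : i \notin B ->
    \sum_k a i k * x k = \sum_k m i k * (x k - x i) - d i * x i.
  move=> /negbTE iB; rewrite /a iB.
  under eq_bigr do rewrite mulrBl -mulrA.
  rewrite sumrB (delta i (fun k => S i * x k)) /S mulrDl mulr_suml opprD addrA -sumrB.
  by congr (_ - _); apply: eq_bigr => k _; rewrite mulrBr.
have [x a0 i|W WE] := injective_solvable a _ (fun i => if i \in B then b i else 0).
  apply: discrete_eq0 => k kB; last by rewrite -(aB k x kB).
  by apply/eqP; rewrite -subr_eq0 -aT// a0.
exists W => i iB; last by rewrite -(aB i W iB) WE iB.
by apply/eqP; rewrite -subr_eq0 -aT// WE (negbTE iB).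
Qed.

End DiscreteDirichlet.

(** * Topology of a network *)

Lemma card_II2_cover {T : choiceType} (A : set T) (x y z : T) :
  (A #= `I_2)%card -> A x -> A y -> x <> y -> A z -> z = x \/ z = y.
Proof.
move=> A2 Ax Ay xy Az; apply: contrapT => /not_orP[zx zy].
pose s := [:: x; y; z].
have us : uniq s.
  by rewrite /= !inE negb_or !andbT; apply/andP; split;
    [apply/andP; split|]; apply/eqP => //; exact: nesym.
have : (`I_3 #<= `I_2)%card.
  have inj : {in `I_3 &, injective (nth x s)}.
    by move=> i k; rewrite !inE /= => i3 k3 /eqP; rewrite nth_uniq// => /eqP.
  apply: (card_le_trans (B := nth x s @` `I_3)).
    by have /card_eqPle[] := inj_card_eq inj.
  apply: (card_le_trans (B := A)); last by have /card_eqPle[] := A2.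
  by apply: subset_card_le => _ [[|[|[|//]]] _ <-].
by rewrite card_le_II.
Qed.

Lemma continuous_bigsetU {T U : topologicalType} {J : eqType} (s : seq J)
    (A : J -> set T) (f : T -> U) :
  (forall j, closed (A j)) -> (forall j, {within A j, continuous f}) ->
  {within \big[setU/set0]_(j <- s) A j, continuous f}.
Proof.
move=> Acl Ac; elim: s => [|j s IH].
  by rewrite big_nil; exact: continuous_subspace0.
by rewrite big_cons; apply: withinU_continuous => //; exact: closed_bigsetU.
Qed.

(** A continuous map from a compact space onto a Hausdorff space is a quotient map:
    closed subsets have compact, hence closed, images. *)
Lemma continuous_on_image {T S U : topologicalType} (K : set T) (p : T -> S)
    (f : S -> U) : hausdorff_space S -> compact K ->
  {within K, continuous p} -> {within K, continuous (f \o p)} ->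
  {within p @` K, continuous f}.
Proof.
move=> hS cK pc fpc; apply/continuous_closedP => W Wcl.
have /continuous_closedP/(_ _ Wcl)/closed_subspaceP[V Vcl VE] := fpc.
apply/closed_subspaceP; exists (p @` (V `&` K)).
  apply: (compact_closed hS); apply: continuous_compact.
    by apply: continuous_subspaceW pc => t [].
  by rewrite setIC; exact: compact_closedI.
apply/seteqP; split=> [_ [[t [Vt Kt] <-] _]|x [Wx [t Kt tx]]].
  split; last by exists t.
  by have : (V `&` K) t by []; rewrite VE => -[].
split; last by exists t.
exists t => //; have : ((f \o p) @^-1` W `&` K) t by split; rewrite /= ?tx.
by rewrite -VE.
Qed.

Lemma row_continuous_within {R : realType} {T : topologicalType} {n : nat} (A : set T)
    (p : T -> 'rV[R]_n) :
  (forall c, {within A, continuous (fun t => p t ord0 c)}) ->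
  {within A, continuous p}.
Proof.
move=> pc; apply/subspace_continuousP => x Ax V [P PV PsV].
have FA : Filter (within A (nbhs x)) by exact: within_filter.
have : \forall t \near within A (nbhs x), forall c : 'I_n, P ord0 c (p t ord0 c).
  apply: filter_forall => c.
  by have /subspace_continuousP/(_ _ Ax) := pc c; apply; exact: PV.
apply: filterS => t Pt; apply: PsV => i c; rewrite ord1; exact: Pt.
Qed.

Definition glue {R : realType} {n : nat} {I J : finType} (G : network R n I J)
    (U : J -> R -> R) (x : 'rV[R]_n) : R :=
  if [pick j | `[< cedge G j x >]] is Some j then U j (param G j x) else 0.

Section Network.
Context {R : realType} {n : nat} {I J : finType} {G : network R n I J}.
Hypothesis HG : topological_network G.

Let l_gt0 := len_gt0 HG.

Lemma curve_continuous (j : J) : {within `[0, len G j], continuous (curve G j)}.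
Proof.
apply: row_continuous_within => c.
by have [_ /(_ 0%N isT)] := curve_smooth HG j c 0.
Qed.

Lemma curve_cedge {j : J} {t : R} : 0 <= t <= len G j -> cedge G j (curve G j t).
Proof. by move=> tl; exists t => //; rewrite /= in_itv. Qed.

Lemma curve_carrier {j : J} {t : R} : 0 <= t <= len G j -> carrier G (curve G j t).
Proof. by move=> /curve_cedge; exists j. Qed.

Lemma paramK {j : J} {t : R} : 0 <= t <= len G j -> param G j (curve G j t) = t.
Proof.
move=> tl; have tl' : t \in `[0, len G j] by rewrite in_itv.
have : [set u | u \in `[0, len G j] /\ curve G j u = curve G j t] !=set0.
  by exists t.
by move=> /getPex[ul]; exact: (curve_inj HG).
Qed.

Let end0 j : 0 <= (0 : R) <= len G j.
Proof. by rewrite lexx ltW. Qed.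

Let end1 j : 0 <= len G j <= len G j.
Proof. by rewrite lexx ltW. Qed.

Lemma edge_ends (j : J) : exists st : I * I,
  [/\ vertex G st.1 = curve G j 0, vertex G st.2 = curve G j (len G j),
      st.1 != st.2 & forall i,
      (j \in Inc G i) = (i == st.1) || (i == st.2)].
Proof.
have [a _ aE] := curve_start HG j; have [b _ bE] := curve_end HG j.
have ne : curve G j 0 <> curve G j (len G j).
  move=> /(curve_inj HG); rewrite !in_itv/= end0 end1 => /(_ isT isT) l0.
  by have := l_gt0 j; rewrite -l0 ltxx.
exists (a, b); split => //=.
  by apply/eqP => ab; apply: ne; rewrite -aE -bE ab.
move=> i; rewrite inE; apply/asboolP/orP => [ci|[/eqP->|/eqP->]].
- have [] := card_II2_cover _ (curve G j 0) (curve G j (len G j)) (vertex G i)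
    (cedge_vertices HG j) (conj (curve_cedge (end0 j)) (curve_start HG j))
    (conj (curve_cedge (end1 j)) (curve_end HG j)) ne.
  + by split => //; exists i.
  + by rewrite -aE => /(vertex_inj HG) ->; left.
  + by rewrite -bE => /(vertex_inj HG) ->; right.
- by rewrite aE; exact: curve_cedge (end0 j).
- by rewrite bE; exact: curve_cedge (end1 j).
Qed.

Lemma vertex_incident (i : I) : exists j, j \in Inc G i.
Proof.
have /set0Pn[k kB] := bnd_neq0 HG.
have k1 : exists j, j \in Inc G k.
  by apply/set0Pn; rewrite -card_gt0; move: kB; rewrite (bnd_leaf HG) => /eqP->.
have /connectP[[|h p] /= ip kE] := vertex_connect HG i k.
  by rewrite -kE.
by case/andP: ip => /existsP[j /andP[ji _]] _; exists j.
Qed.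

(** ** Vertices as ends of edges *)

Context {src tgt : J -> I}.
Hypothesis ends : forall j, [/\ vertex G (src j) = curve G j 0,
  vertex G (tgt j) = curve G j (len G j), src j != tgt j &
  forall i, (j \in Inc G i) = (i == src j) || (i == tgt j)].

Lemma vertex_param {i : I} {j : J} {t : R} : 0 <= t <= len G j ->
  curve G j t = vertex G i -> (t = 0 /\ i = src j) \/ (t = len G j /\ i = tgt j).
Proof.
move=> tl ti; have [sE tE _ incE] := ends j.
have in_itv' u : 0 <= u <= len G j -> u \in `[0, len G j] by rewrite in_itv.
have : j \in Inc G i.
  by rewrite inE; apply/asboolP; rewrite -ti; exact: curve_cedge.
rewrite incE => /orP[/eqP iE|/eqP iE]; [left|right]; split => //;
  apply: (curve_inj HG (j := j)); rewrite ?in_itv' //.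
- by rewrite ti iE sE.
- by rewrite ti iE tE.
Qed.

Lemma edge_meetP {j k : J} {x : 'rV[R]_n} : cedge G j x -> cedge G k x ->
  j = k \/ exists i, x = vertex G i.
Proof.
move=> jx kx; have [|jk] := eqVneq j k; first by left.
by right; have [i _ iE] := cedge_meet HG jk (conj jx kx); exists i.
Qed.

(** Two edges only meet at vertices, where the values prescribed by [v] agree, so
    the edge picked by [glue] does not matter. *)
Lemma glueE {U : J -> R -> R} {v : I -> R} :
  (forall j, U j 0 = v (src j)) -> (forall j, U j (len G j) = v (tgt j)) ->
  forall j t, 0 <= t <= len G j -> glue G U (curve G j t) = U j t.
Proof.
move=> U0 U1 j t tl; rewrite /glue; case: pickP => [k /asboolP kx|/(_ j)]; last first.
  by move=> /negP[]; apply/asboolP; exact: curve_cedge.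
have [<-|[i xi]] := edge_meetP (curve_cedge tl) kx; first by rewrite paramK.
have vE h u : 0 <= u <= len G h -> curve G h u = vertex G i -> U h u = v i.
  by move=> ul /(vertex_param ul)[[-> ->]|[-> ->]].
move: kx; rewrite (vE _ _ tl xi) => -[u]; rewrite /= in_itv/= => ul ux.
by rewrite -ux paramK// (vE _ _ ul)// ux.
Qed.

(** The closed edges form a finite closed cover of the network. *)
Lemma edgewise_continuous {T : topologicalType} (u : 'rV[R]_n -> T) :
  (forall j, {within `[0, len G j], continuous (u \o curve G j)}) ->
  {within carrier G, continuous u}.
Proof.
move=> uc.
have -> : carrier G = \big[setU/set0]_(j <- enum J) cedge G j.
  rewrite -bigcup_seq; congr bigcup; apply/seteqP; split => // j _ /=.
  by rewrite mem_enum.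
apply: continuous_bigsetU => j.
  apply: compact_closed; first exact: norm_hausdorff.
  by apply: continuous_compact; [exact: curve_continuous|exact: segment_compact].
apply: continuous_on_image; [exact: norm_hausdorff|exact: segment_compact| |].
- exact: curve_continuous.
- exact: uc.
Qed.

End Network.

(** * The Dirichlet problem on the network *)

Section Dirichlet.
Context {R : realType} {n : nat} {I J : finType} {G : network R n I J}.
Context {beta : I -> J -> R} {f : 'rV[R]_n -> R} {eps : R}.
Hypothesis HG : topological_network G.
Hypothesis beta_ge0 : forall i j, i \in transition G -> j \in Inc G i ->
  0 <= beta i j.
Hypothesis beta_nd : beta_nondegenerate G beta.
Hypothesis f_cont : {within carrier G, continuous f}.
Hypothesis f_ge0 : forall x, carrier G x -> 0 <= f x.
Hypothesis eps_gt0 : 0 < eps.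

Let l_gt0 := len_gt0 HG.

Let end0 j : 0 <= (0 : R) <= len G j.
Proof. by rewrite lexx ltW. Qed.

Let end1 j : 0 <= len G j <= len G j.
Proof. by rewrite lexx ltW. Qed.

(** [f / eps ^ 2] in the coordinate of an edge, extended by constants to the line. *)
Definition potential (j : J) (t : R) : R :=
  f (curve G j (clamp (len G j) t)) / eps ^+ 2.

Lemma potential_ge0 (j : J) (t : R) : 0 <= potential j t.
Proof.
rewrite divr_ge0 ?exprn_ge0 ?(ltW eps_gt0)// f_ge0//.
exact/curve_carrier/(clamp_itv (l_gt0 j)).
Qed.

Lemma potential_continuous (j : J) : continuous (potential j).
Proof.
have fc : {within `[0, len G j], continuous (f \o curve G j)}.
  apply/subspace_continuousP => t tl V fV.
  have tl' : 0 <= t <= len G j by move: tl; rewrite /= in_itv.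
  have /subspace_continuousP/(_ _ (curve_carrier tl') V fV) := f_cont.
  have /subspace_continuousP/(_ _ tl) pc := curve_continuous HG j.
  move=> /pc; rewrite /within/= => H.
  have : \forall u \near t, `[0, len G j]%classic u ->
      carrier G (curve G j u) -> V (f (curve G j u)) by exact: H.
  apply: filterS => u hu ul; apply: hu => //.
  by apply: curve_carrier; move: ul; rewrite /= in_itv.
move=> t; apply: (@continuousM _ _ _ (fun=> (eps ^+ 2)^-1)); last exact: cst_continuous.
exact: (clamp_comp_continuous (l_gt0 j) _ fc).
Qed.

Lemma potential_bounded (j : J) : exists K, forall t, `|potential j t| <= K.
Proof.
have [x _ xmax] := EVT_max (ltW (l_gt0 j))
  (continuous_subspaceT (potential_continuous j)).
exists (potential j x) => t; rewrite ger0_norm ?potential_ge0//.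
have := clamp_itv (l_gt0 j) t.
move=> tl; have := xmax (clamp (len G j) t); rewrite in_itv/= => /(_ tl).
by rewrite {1}/potential clamp_id.
Qed.

Context {src tgt : J -> I}.
Hypothesis ends : forall j, [/\ vertex G (src j) = curve G j 0,
  vertex G (tgt j) = curve G j (len G j), src j != tgt j &
  forall i, (j \in Inc G i) = (i == src j) || (i == tgt j)].

Context {c c1 s s1 : J -> R -> R}.
Hypothesis cs : forall j, fundamental (potential j) (c j) (c1 j) (s j) (s1 j).

Let len_s j : R := s j (len G j).

Let len_s_gt0 j : 0 < len_s j.
Proof. exact: (fund_s_gt0 (cs j) (potential_ge0 j)). Qed.

(** A solution of [y'' = q y] on an edge of length [l], with value [a] at one end
    and [b] at the other, has slope [(b - a) / s l - leak * a] at the first end in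
    the direction of the edge.  So an edge acts as a conductance [1 / s l] with a
    leak at each end, which is nonnegative since [c >= 1] and [s' >= 1]. *)
Definition leak (i : I) (j : J) : R :=
  ((if i == src j then c j (len G j) else s1 j (len G j)) - 1) / len_s j.

Definition weight (i k : I) : R :=
  \sum_(j in Inc G i | j \in Inc G k) beta i j / len_s j.

Definition loss (i : I) : R := \sum_(j in Inc G i) beta i j * leak i j.

Lemma weight_ge0 (i k : I) : i \notin bnd G -> 0 <= weight i k.
Proof.
move=> iB; apply: sumr_ge0 => j /andP[ji _].
by rewrite divr_ge0 ?(ltW (len_s_gt0 j))// beta_ge0// inE.
Qed.

Lemma loss_ge0 (i : I) : i \notin bnd G -> 0 <= loss i.
Proof.
move=> iB; apply: sumr_ge0 => j ji; apply: mulr_ge0.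
  by apply: beta_ge0 => //; rewrite inE.
rewrite /leak divr_ge0 ?(ltW (len_s_gt0 j))// subr_ge0.
case: ifP => _; first exact: (fund_c_ge1 (cs j) (potential_ge0 j)).
exact: (fund_s1_ge1 (cs j) (potential_ge0 j) _ (ltW (l_gt0 j))).
Qed.

(** Every arc of [beta_step] has positive weight, so nondegeneracy of [beta] carries
    over to [weight]. *)
Lemma weight_reach (i : I) : i \notin bnd G -> exists2 k, k \in bnd G &
  connect (fun i k => (i \notin bnd G) && (0 < weight i k)) i k.
Proof.
move=> iB; have [|k kB ik] := beta_nd i; first by rewrite inE.
exists k => //; move: ik; apply: connect_sub => {iB kB}i {}k.
move=> /andP[iT /existsP[j /and3P[ji jk bij]]]; apply: connect1.
have iB : i \notin bnd G by move: iT; rewrite inE.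
rewrite iB /weight (bigD1 j) ?ji//=; apply: ltr_pwDl; first exact: divr_gt0.
apply: sumr_ge0 => h /andP[/andP[hi _] _].
by rewrite divr_ge0 ?(ltW (len_s_gt0 h))// beta_ge0.
Qed.

Definition edgewise_viscous (u : 'rV[R]_n -> R) : Prop := forall j,
  itv_Ck 2 (len G j) (u \o curve G j) /\
  viscous_eq (potential j) (len G j) eps (u \o curve G j).

Definition hopf_cole_vertex (u : 'rV[R]_n -> R) (i : I) : R :=
  expR (- u (vertex G i) / eps).

(** For [y = exp (- u / eps)] the derivative of [u] is [- eps y' / y], so
    multiplication by the vertex value [W i] of [y] makes the outgoing derivative linear.  The sum over the
    two ends [k] of [j] avoids naming the other end: the term [k = i] is 0. *)
Lemma flux (u : 'rV[R]_n -> R) (i : I) (j : J) : edgewise_viscous u ->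
  j \in Inc G i -> let W := hopf_cole_vertex u in
  W i * (incidence G i j * dedge G 1 j u (vertex G i)) =
  - eps * (\sum_(k | j \in Inc G k) (W k - W i) / len_s j - leak i j * W i).
Proof.
move=> uE ji W; have [sE tE st incE] := ends j.
have [u2 uj] := uE j.
have [_] := hopf_cole (l_gt0 j) eps_gt0 (potential_ge0 j) (cs j) _ u2 uj.
rewrite /= -sE -tE -/(hopf_cole_vertex u (src j)) -/(hopf_cole_vertex u (tgt j)) -/W.
rewrite -/(len_s j) => E0 E1.
have ls : len_s j != 0 by rewrite gt_eqF.
have -> : \sum_(k | j \in Inc G k) (W k - W i) / len_s j =
    (W (src j) - W i) / len_s j + (W (tgt j) - W i) / len_s j.
  rewrite (bigD1 (src j)) ?incE ?eqxx//=; congr (_ + _).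
  rewrite (bigD1 (tgt j)) ?incE ?eqxx ?orbT//=; last by rewrite eq_sym.
  rewrite big1 ?addr0// => k; rewrite incE => /andP[/andP[/orP[]/eqP->]];
    by rewrite eqxx ?andbF.
have c0l : curve G j 0 == curve G j (len G j) = false.
  by rewrite -sE -tE (inj_eq (vertex_inj HG)) (negbTE st).
rewrite /incidence /dedge /leak ji /=.
move: (ji); rewrite incE => /orP[]/eqP iE; rewrite iE.
  rewrite {1 2 3}sE !eqxx (paramK HG (end0 j)) mul1r E0 subrr mul0r add0r.
  by congr (_ * _); field.
rewrite {1 2 3}tE c0l eqxx (paramK HG (end1 j)) [tgt j == _]eq_sym (negbTE st).
rewrite mulN1r mulrN E1 subrr mul0r addr0 -mulrN.
by congr (_ * _); field.
Qed.

Lemma kirchhoff_discrete (u : 'rV[R]_n -> R) (i : I) : edgewise_viscous u ->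
  let W := hopf_cole_vertex u in
  W i * kirchhoff G beta u i =
  - eps * (\sum_k weight i k * (W k - W i) - loss i * W i).
Proof.
move=> uE W; rewrite /kirchhoff mulr_sumr.
rewrite (eq_bigr (fun j => - eps * (\sum_(k | j \in Inc G k)
    beta i j / len_s j * (W k - W i) - beta i j * leak i j * W i))); last first.
  move=> j ji; rewrite -mulrA mulrCA (flux _ _ _ uE ji) mulrCA; congr (_ * _).
  rewrite mulrBr mulrA mulr_sumr; congr (_ - _); apply: eq_bigr => k _.
  by rewrite mulrCA mulrC.
rewrite -mulr_sumr sumrB -mulr_suml; congr (_ * (_ - _)).
rewrite (exchange_big_dep xpredT)//=; apply: eq_bigr => k _.
by rewrite -mulr_suml.
Qed.

Lemma discrete_kirchhoff (u : 'rV[R]_n -> R) : edgewise_viscous u ->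
  discrete_eq (bnd G) weight loss (hopf_cole_vertex u) <->
  (forall i, i \in transition G -> kirchhoff G beta u i = 0).
Proof.
move=> uE; have W0 i : hopf_cole_vertex u i != 0 by rewrite gt_eqF ?expR_gt0.
have e0 : - eps != 0 by rewrite oppr_eq0 gt_eqF.
split=> H i.
  rewrite inE => /H/eqP; rewrite -subr_eq0 => /eqP E.
  apply: (mulfI (W0 i)); rewrite kirchhoff_discrete// E !mulr0//.
move=> iB; apply/eqP; rewrite -subr_eq0; apply/eqP/(mulfI e0).
by rewrite -kirchhoff_discrete// H ?inE// !mulr0.
Qed.

Lemma eps2_potential {j : J} {t : R} : 0 <= t <= len G j ->
  eps ^+ 2 * potential j t = f (curve G j t).
Proof. by move=> tl; rewrite /potential clamp_id// mulrC divfK// expf_neq0// gt_eqF. Qed.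

(** The Hopf-Cole transform turns the problem on the network into a linear system
    for the values at the vertices. *)
Lemma viscous_solutionP (g : I -> R) (u : 'rV[R]_n -> R) :
  viscous_solution G beta f g eps u <->
  [/\ edgewise_viscous u,
      discrete_eq (bnd G) weight loss (hopf_cole_vertex u) &
      forall i, i \in bnd G -> u (vertex G i) = g i].
Proof.
have oc j t : 0 < t < len G j -> 0 <= t <= len G j.
  by move=> /andP[? ?]; rewrite !ltW.
split=> [[[[_ uC] uK] uE ug]|[uE uD ug]].
  have ue : edgewise_viscous u.
    move=> j; split => // t tl; rewrite eps2_potential ?oc//.
    have := uE j (curve G j t); rewrite /dedge paramK ?oc//; apply.
    by exists t => //; rewrite /= in_itv.
  by split => //; exact/discrete_kirchhoff.
split => //; first split; first split.
- apply: (edgewise_continuous HG) => j.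
  by have [[_ uc] _] := uE j; exact: (uc 0%N isT).
- by move=> j; have [] := uE j.
- exact/discrete_kirchhoff.
- move=> j _ [t + <-]; rewrite /= in_itv/= => tl.
  by rewrite /dedge paramK ?oc// -eps2_potential ?oc//; have [_] := uE j; exact.
Qed.

Lemma viscous_solution_uniq (g : I -> R) (u w : 'rV[R]_n -> R) :
  viscous_solution G beta f g eps u -> viscous_solution G beta f g eps w ->
  forall x, carrier G x -> w x = u x.
Proof.
move=> /viscous_solutionP[uE uD ug] /viscous_solutionP[wE wD wg].
have uw := discrete_uniq _ _ _ weight_ge0 loss_ge0 weight_reach _ _ uD wD.
have {}uw i : hopf_cole_vertex u i = hopf_cole_vertex w i.
  by apply: uw => k kB; rewrite /hopf_cole_vertex ug// wg.
move=> _ [j _ [t + <-]]; rewrite /= in_itv/= => tl.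
have [sE tE _ _] := ends j.
have [u2 uj] := uE j; have [w2 wj] := wE j.
have [/(_ t tl) + _ _] := hopf_cole (l_gt0 j) eps_gt0 (potential_ge0 j) (cs j) _ u2 uj.
have [/(_ t tl) + _ _] := hopf_cole (l_gt0 j) eps_gt0 (potential_ge0 j) (cs j) _ w2 wj.
move: (uw (src j)) (uw (tgt j)); rewrite /hopf_cole_vertex sE tE /= => -> -> <-.
by move=> /expR_inj /(mulIf _) /oppr_inj -> //; rewrite invr_eq0 gt_eqF.
Qed.

Lemma viscous_solution_exists (g : I -> R) :
  exists u, viscous_solution G beta f g eps u.
Proof.
have e0 : eps != 0 by rewrite gt_eqF.
have [W WD Wg] := discrete_exists _ _ _ weight_ge0 loss_ge0 weight_reach
  (fun i => expR (- g i / eps)).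
have W_gt0 : forall i, 0 < W i.
  apply: (discrete_gt0 _ _ _ weight_ge0 loss_ge0 weight_reach _ WD) => i iB.
  by rewrite Wg// expR_gt0.
have /choice[U UP] j := hopf_cole_inv (l_gt0 j) eps_gt0 (potential_continuous j)
  (potential_ge0 j) (cs j) _ _ (W_gt0 (src j)) (W_gt0 (tgt j)).
pose v i := - eps * ln (W i).
have UE := glueE HG ends (U := U) (v := v) (fun j => let: And4 _ _ a _ := UP j in a)
  (fun j => let: And4 _ _ _ b := UP j in b).
have vE i : glue G U (vertex G i) = v i.
  have [j] := vertex_incident HG i; have [sE tE _ ->] := ends j.
  have [_ _ U0 U1] := UP j.
  case/orP=> /eqP->; first by rewrite sE (UE j 0 (end0 j)).
  by rewrite tE (UE j _ (end1 j)).
have VW : hopf_cole_vertex (glue G U) = W.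
  apply/funext => i; rewrite /hopf_cole_vertex vE /v.
  by rewrite -mulNr opprK mulrAC divff// mul1r lnK// posrE.
exists (glue G U); apply/viscous_solutionP; split; last 2 first.
- by rewrite VW.
- by move=> i iB; rewrite vE /v Wg// expRK; field.
move=> j; have [U2 Uj _ _] := UP j.
have [V [V1 [V2 UV]]] := itv_C2_extension (l_gt0 j) _ U2.
have gV : C2_extension (len G j) (glue G U \o curve G j) V V1 V2.
  by move=> t tl; have [UVt ? ? ?] := UV t tl; split => //; rewrite -UVt -(UE j t tl).
split; first exact: (C2_extension_itv_C2 (l_gt0 j) gV).
move=> t tl; have tl' : 0 <= t <= len G j by case/andP: tl => ? ?; rewrite !ltW.
have := Uj t tl.
have [-> ->] := C2_extension_derive (l_gt0 j) UV t tl'.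
by have [-> ->] := C2_extension_derive (l_gt0 j) gV t tl'.
Qed.

End Dirichlet.

(** * Well-posedness *)

Theorem theorem3p3 (R : realType) (n : nat) (I J : finType)
    (G : network R n I J) (HG : topological_network G)
    (beta : I -> J -> R)
    (beta_ge0 : forall i j, i \in transition G -> j \in Inc G i ->
       0 <= beta i j)
    (beta_nd : beta_nondegenerate G beta)
    (f : 'rV[R]_n -> R)
    (f_cont : {within carrier G, continuous f})
    (f_ge0 : forall x, carrier G x -> 0 <= f x)
    (g : I -> R) (eps : R) (eps_gt0 : 0 < eps) :
  exists2 u : 'rV[R]_n -> R,
    viscous_solution G beta f g eps u &
    forall w : 'rV[R]_n -> R, viscous_solution G beta f g eps w ->
      forall x, carrier G x -> w x = u x.
Proof.
have [st ends] := choice (edge_ends HG).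
have q_cont := potential_continuous HG f_cont (eps := eps).
have q_bound := potential_bounded HG f_cont f_ge0 eps_gt0.
have : forall j, exists c c1 s s1,
    fundamental (potential (G := G) (f := f) (eps := eps) j) c c1 s s1.
  by move=> j; have [K] := q_bound j; exact: fundamental_exists.
move=> /choice[c /choice[c1 /choice[s /choice[s1 cs]]]].
have [u uS] := viscous_solution_exists HG beta_ge0 beta_nd f_cont f_ge0 eps_gt0 ends cs g.
exists u => // w wS.
exact: (viscous_solution_uniq HG beta_ge0 beta_nd f_ge0 eps_gt0 ends cs g _ _ uS wS).
Qed.
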